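(* Let $d=2$, $\varepsilon>0$, $P\in\mathbb{N}_0$, and let $\omega_h\in W^{-(m+1),2}(\Omega)$ for some $m\in\mathbb{N}_0$. Let $\omega_\sigma\in V_\sigma^P(\Omega_\sigma)$ be the solution of $$A(\omega_\sigma,v_\sigma)=\omega_h(v_\sigma)\qquad\forall v_\sigma\in V_\sigma^P(\Omega_\sigma),$$ where $A(w,v)=\int_\Omega wv\,\mathrm{d}x+\varepsilon j(w,v)$. Then $$(\omega_\sigma,x^\alpha)_{L^2(\Omega)}=\omega_h(x^\alpha)\qquad\text{for all multi-indices }\alpha\text{ with }|\alpha|\leq P.$$ Consequently, for $P=1$ the circulation $I_0$ and the linear momentum $\mathbf{I}_1$ are conserved (i.e. have the same values for $\omega_\sigma$ as for $\omega_h$), and for $P=2$ the angular momentum $I_2$ is conserved additionally.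
   Context: Conserved quantities. For a function $\omega$ on $\Omega\subset\mathbb{R}^2$: $I_0=\int_\Omega 1\cdot\omega\,\mathrm{d}x$, $\mathbf{I}_1=\int_\Omega(x_2,-x_1)^\top\omega\,\mathrm{d}x$, $I_2=\int_\Omega|x|^2\omega\,\mathrm{d}x$; for $\omega_h$ these are obtained by applying the functional $\omega_h$ to the polynomials $1$, $x_2$, $-x_1$, $|x|^2$. $W^{-k,2}(\Omega):=W^{k,2}(\Omega)'$ is the dual of the full space $W^{k,2}(\Omega)$, and $\omega_h(v_\sigma)$ means $\omega_h$ applied to $v_\sigma|_\Omega$. Grid (with $d=2$). Let $\sigma>0$. For $i\in\mathbb{Z}^d$ let $x_i:=(i_1\sigma,\ldots,i_d\sigma)$ be the Cartesian grid points (nodes), $\Omega_i:=\prod_{l=1}^d((i_l-1)\sigma,(i_l+1)\sigma)$ the patches, $\omega_i:=\prod_{l=1}^d((i_l-\tfrac12)\sigma,(i_l+\tfrac12)\sigma)$ the patch-cores, and $Q_i:=\prod_{l=1}^d(i_l\sigma,(i_l+1)\sigma)$ the elements. Partition of unity. Let $\zeta:\mathbb{R}\to\mathbb{R}$, $\zeta(x)=K^{-1}\exp(-1/(1-4x^2))$ for $|x|<\tfrac12$ and $\zeta(x)=0$ otherwise, with $K>0$ such that $\|\zeta\|_{L^1(\mathbb{R})}=1$; on $\mathbb{R}^d$ put $\zeta(x)=\prod_{l=1}^d\zeta(x_l)$ and $\zeta_\sigma(x)=\sigma^{-d}\zeta(x/\sigma)$. Set $\varphi_i:=\chi_{\omega_i}\star\zeta_\sigma$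 (convolution with the characteristic function of $\omega_i$). The $\varphi_i$ are $C^\infty$, have support $\operatorname{clos}\Omega_i$, and sum to $1$. Domains. $\Omega\subset\mathbb{R}^d$ is a bounded domain for which Stein's extension theorem holds (there is a bounded linear extension operator $W^{k,2}(\Omega)\to W^{k,2}(\mathbb{R}^d)$ for every $k\in\mathbb{N}$). The fictitious domain is $\Omega_\sigma:=\operatorname{int}\bigcup\lbrace\operatorname{clos}Q_i\mid\operatorname{meas}_d(Q_i\cap\Omega)>0\rbrace$; the cut part is $\Omega_\sigma^\Gamma:=\operatorname{int}\bigcup\lbrace\operatorname{clos}Q_i\mid Q_i\subset\Omega_\sigma,\ Q_i\not\subset\Omega\rbrace$; the uncut part is $\Omega_\sigma^\circ:=\operatorname{int}\bigcup\lbrace\operatorname{clos}Q_i\mid Q_i\subset\Omega_\sigma,\ Q_i\subset\Omega\rbrace$. One writes $Q_i\in\Omega_\sigma^\Gamma$ for $Q_i\subset\Omega_\sigma^\Gamma$, and similarly for the other domains. Two elements are neighbors if they share at least one grid node. Standing assumption: for every $Q_i\in\Omega_\sigma^\Gamma$ there is a finite sequence $(Q_i=Q_{i,1},\ldots,Q_{i,K})$ of elements in $\Omega_\sigma^\Gamma$ with $K$ bounded independently of $\sigma$, any two subsequent elements being neighbors, and $Q_{i,K}$ having a neighbor in $\Omega_\sigma^\circ$ (if necessary, this is enforced by moving additional elements from $\Omega_\sigma^\circ$ to $\Omega_\sigma^\Gamma$). Space and forms. $V_\sigma^P(\Omega_\sigma)$ is the span of the functions $\varphi_i x^\alpha$,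 $|\alpha|\leq P$, $i\in\mathbb{Z}^d$, restricted to $\Omega_\sigma$. The stabilization form is $$j(u,v):=\sigma^{2(P+1)}\sum_{Q_i\in\Omega_\sigma^\Gamma}\sum_{|\alpha|=P+1}\int_{Q_i}(\partial^\alpha u)(\partial^\alpha v)\,\mathrm{d}x.$$ *)

(* Defs.v *)
From HB Require Import structures.
From mathcomp Require Import all_boot all_order all_algebra.
From mathcomp Require Import all_classical all_reals all_analysis.

Set Implicit Arguments.
Unset Strict Implicit.
Unset Printing Implicit Defensive.

Import Order.TTheory GRing.Theory Num.Theory.
Import numFieldNormedType.Exports.

Local Open Scope classical_set_scope.
Local Open Scope ring_scope.

(** The plane is [R * R], multi-indices are pairs of naturals, and elements of
    function spaces on [Om] are represented by total functions on the plane of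
    which only the values on [Om] matter. *)

Section Plane.
Variable R : realType.

Definition leb2 :
    {measure set (measurableTypeR R * measurableTypeR R) -> \bar R} :=
  (@lebesgue_measure R \x @lebesgue_measure R)%E.

Definition mdeg (a : nat * nat) : nat := (a.1 + a.2)%N.

Definition monomial (a : nat * nat) (x : R * R) : R := x.1 ^+ a.1 * x.2 ^+ a.2.

(** [partial false] is the derivative in [x.1], [partial true] that in [x.2]. *)
Definition partial (b : bool) (f : R * R -> R) : R * R -> R :=
  'D_(if b then (0, 1) else (1, 0)) f.

Definition pderiv (a : nat * nat) (f : R * R -> R) : R * R -> R :=
  iter a.1 (partial false) (iter a.2 (partial true) f).

Definition smooth (f : R * R -> R) : Prop :=
  forall (w : seq bool) (x : R * R), differentiable (foldr partial f w) x.

Definition test_function (Om : set (R * R)) (f : R * R -> R) : Prop :=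
  [/\ smooth f, compact (closure [set x | f x != 0]) &
      closure [set x | f x != 0] `<=` Om].

Definition is_domain (Om : set (R * R)) : Prop :=
  [/\ open Om, connected Om & Om !=set0].

End Plane.

Section Sobolev.
Variable R : realType.
Implicit Types (Om : set (R * R)) (u v : R * R -> R).

Definition L2_on Om u : Prop :=
  measurable_fun (Om : set (measurableTypeR R * measurableTypeR R)) u /\
  (leb2 R).-integrable Om (fun x => (u x ^+ 2)%:E).

Definition weak_deriv Om (a : nat * nat) u v : Prop :=
  forall f, test_function Om f ->
    \int[leb2 R]_(x in Om) (u x * pderiv a f x) =
    (-1) ^+ mdeg a * \int[leb2 R]_(x in Om) (v x * f x).

(** [u] belongs to W^{k,2}(Om) and [N] is its norm there. Weak derivatives are
    unique almost everywhere, so [N] is determined by [u]. *)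
Definition sobolev_norm Om (k : nat) u (N : R) : Prop :=
  L2_on Om u /\
  exists2 g : nat * nat -> R * R -> R,
    (forall a, (mdeg a <= k)%N -> L2_on Om (g a) /\ weak_deriv Om a u (g a)) &
    N = Num.sqrt (\sum_(i < k.+1) \sum_(j < k.+1 | (i + j <= k)%N)
          \int[leb2 R]_(x in Om) (g (nat_of_ord i, nat_of_ord j) x ^+ 2)).

Definition sobolev Om (k : nat) u : Prop := exists N, sobolev_norm Om k u N.

(** Bounded linear functionals on W^{k,2}(Om); boundedness entails that [l]
    only depends on the class of its argument modulo equality a.e. on [Om]. *)
Definition sobolev_dual Om (k : nat) (l : (R * R -> R) -> R) : Prop :=
  (forall (c : R) u v, sobolev Om k u -> sobolev Om k v ->
     l (fun x => c * u x + v x) = c * l u + l v) /\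
  (exists C : R, forall u N, sobolev_norm Om k u N -> `|l u| <= C * N).

Definition stein_extension Om : Prop :=
  forall k : nat, exists E : (R * R -> R) -> R * R -> R,
  [/\ forall u, sobolev Om k u ->
        {ae leb2 R, forall x, Om x -> E u x = u x},
      forall (c : R) u v, sobolev Om k u -> sobolev Om k v ->
        {ae leb2 R, forall x,
           E (fun y => c * u y + v y) x = c * E u x + E v x} &
      exists C : R, forall u N, sobolev_norm Om k u N ->
        exists2 M, sobolev_norm [set: R * R] k (E u) M & M <= C * N].

End Sobolev.

Section Grid.
Variables (R : realType) (s : R).
Implicit Types i j : int * int.

Definition node i : R * R := (i.1%:~R * s, i.2%:~R * s).

Definition patch_core i : set (R * R) :=
  [set x | (i.1%:~R - 2^-1) * s < x.1 < (i.1%:~R + 2^-1) * s /\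
           (i.2%:~R - 2^-1) * s < x.2 < (i.2%:~R + 2^-1) * s].

Definition cell i : set (R * R) :=
  [set x | i.1%:~R * s < x.1 < (i.1 + 1)%:~R * s /\
           i.2%:~R * s < x.2 < (i.2 + 1)%:~R * s].

Definition neighbors i j : Prop :=
  exists n, closure (cell i) (node n) /\ closure (cell j) (node n).

Definition cells_interior (I : set (int * int)) : set (R * R) :=
  interior (\bigcup_(i in I) closure (cell i)).

Variable Om : set (R * R).

Definition fict_domain : set (R * R) :=
  cells_interior [set i | (0 < leb2 R (cell i `&` Om))%E].

(** [mv] collects the elements moved from the uncut to the cut part in order
    to enforce [chain_condition]; [mv = set0] gives the unmodified parts. *)
Variable mv : set (int * int).

Definition cut_part : set (R * R) :=
  cells_interior
    [set i | cell i `<=` fict_domain /\ (~ (cell i `<=` Om) \/ mv i)].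

Definition uncut_part : set (R * R) :=
  cells_interior
    [set i | [/\ cell i `<=` fict_domain, cell i `<=` Om & ~ mv i]].

Definition movable : set (int * int) :=
  [set i | cell i `<=` fict_domain /\ cell i `<=` Om].

Definition chain_condition (K : nat) : Prop :=
  forall i, cell i `<=` cut_part ->
  exists (n : nat) (c : nat -> int * int),
  [/\ (n < K)%N /\ c 0%N = i,
      forall k, (k <= n)%N -> cell (c k) `<=` cut_part,
      forall k, (k < n)%N -> neighbors (c k) (c k.+1) &
      exists2 j, cell j `<=` uncut_part & neighbors (c n) j].

End Grid.

(** [mesh] is the set of mesh sizes under consideration: the bound [K] is uniform
    over [mesh]. Meshes too coarse to have any uncut element must be left out. *)
Definition grid_assumption (R : realType) (Om : set (R * R)) (mesh : set R)
    (mv : R -> set (int * int)) : Prop :=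
  (forall s, mesh s -> 0 < s /\ mv s `<=` movable s Om) /\
  exists K : nat, forall s, mesh s -> chain_condition s Om (mv s) K.

Section Space.
Variable R : realType.

(** [K] is a parameter here; the intended value is the positive one for which
    [zeta1 K] has unit L^1 norm. *)
Definition zeta1 (K : R) (t : R) : R :=
  if `|t| < 2^-1 then K^-1 * expR (- 1 / (1 - 4 * t ^+ 2)) else 0.

Definition zeta2 (K : R) (x : R * R) : R := zeta1 K x.1 * zeta1 K x.2.

Definition zeta_scaled (K s : R) (x : R * R) : R :=
  s ^- 2 * zeta2 K (x.1 / s, x.2 / s).

Definition convolution (f g : R * R -> R) (x : R * R) : R :=
  \int[leb2 R]_(y in [set: R * R]) (f y * g (x - y)).

Definition pou (K s : R) (i : int * int) : R * R -> R :=
  convolution \1_(patch_core s i) (zeta_scaled K s).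

(** V_s^P(D): functions agreeing on [D] with a finite linear combination of the
    [pou K s i * monomial a], |a| <= P. *)
Definition Vspace (K s : R) (P : nat) (D : set (R * R)) (v : R * R -> R) :
    Prop :=
  exists (r : seq (int * int)) (c : int * int -> nat * nat -> R),
  forall x, D x ->
    v x = \sum_(i <- r) \sum_(a1 < P.+1) \sum_(a2 < P.+1 | (a1 + a2 <= P)%N)
      c i (nat_of_ord a1, nat_of_ord a2) *
        (pou K s i x * monomial (nat_of_ord a1, nat_of_ord a2) x).

Definition jform (s : R) (Om : set (R * R)) (mv : set (int * int)) (P : nat)
    (u v : R * R -> R) : R :=
  s ^+ (2 * P.+1) *
  \sum_(i \in [set i | cell s i `<=` cut_part s Om mv])
    \sum_(k < P.+2)
      \int[leb2 R]_(x in cell s i)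
        (pderiv (nat_of_ord k, P.+1 - k)%N u x *
         pderiv (nat_of_ord k, P.+1 - k)%N v x).

Definition L2_inner (Om : set (R * R)) (u v : R * R -> R) : R :=
  \int[leb2 R]_(x in Om) (u x * v x).

Definition Aform (s : R) (Om : set (R * R)) (mv : set (int * int)) (P : nat)
    (eps : R) (u v : R * R -> R) : R :=
  L2_inner Om u v + eps * jform s Om mv P u v.

End Space.

Section Conserved.
Variable R : realType.
Implicit Types (Om : set (R * R)) (w : R * R -> R) (l : (R * R -> R) -> R).

Definition circulation Om w : R := \int[leb2 R]_(x in Om) (1 * w x).

Definition linear_momentum Om w : R * R :=
  (\int[leb2 R]_(x in Om) (x.2 * w x),
   \int[leb2 R]_(x in Om) (- x.1 * w x)).

Definition angular_momentum Om w : R :=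
  \int[leb2 R]_(x in Om) ((x.1 ^+ 2 + x.2 ^+ 2) * w x).

Definition circulation_fun l : R := l (fun=> 1).

Definition linear_momentum_fun l : R * R :=
  (l (fun x => x.2), l (fun x => - x.1)).

Definition angular_momentum_fun l : R := l (fun x => x.1 ^+ 2 + x.2 ^+ 2).

End Conserved.

(* Main.v *)
Require Import Defs.
From mathcomp Require Import all_boot all_order all_algebra.
From mathcomp Require Import all_classical all_reals all_analysis.
From mathcomp Require Import measurable_realfun lra ring.
Set Implicit Arguments.
Unset Strict Implicit.
Unset Printing Implicit Defensive.
Import Order.TTheory GRing.Theory Num.Theory.
Import numFieldNormedType.Exports.
Local Open Scope classical_set_scope.
Local Open Scope ring_scope.

(** Summed over a large enough finite block of nodes, the [pou K s i] equal 1 on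
    the bounded fictitious domain, so every polynomial of degree at most P lies
    in the ansatz space. It is therefore an admissible test function; the
    stabilization form, which only sees derivatives of order P + 1, vanishes
    on it, and the Galerkin equation reduces to equality of moments. *)

(** * Continuity and sign of the bump kernel *)

Section Kernel.
Variable R : realType.
Implicit Types K s t u : R.

(** The classical flat function. Composed with [1 - 4 * t ^+ 2] it gives the bump, so the two cut
    points of [zeta1] become the single one at 0. *)
Definition expNV (u : R) : R := if 0 < u then expR (- u^-1) else 0.

(** Follows from [1 + u^-1 <= expR (u^-1)]. It squeezes [expNV] to 0 at the origin, the only
    delicate point for continuity. *)
Lemma normr_expNV_le u : `|expNV u| <= `|u|.
Proof.
rewrite /expNV; case: ifPn => [u0|_]; last by rewrite normr0.
rewrite !gtr0_norm ?expR_gt0// expRN -[leRHS]invrK lef_pV2 ?posrE ?invr_gt0//.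
  by apply: le_trans (expR_ge1Dx _); rewrite lerDr ler01.
exact: expR_gt0.
Qed.

Lemma continuous_expNV : continuous expNV.
Proof.
move=> u; rewrite /continuous_at.
have [u0|u0|u0] := ltgtP 0 u; last rewrite -u0.
- have -> : expNV u = expR (- u^-1) by rewrite /expNV u0.
  apply: (@cvg_trans _ (expR (- v^-1) @[v --> u])).
    apply: near_eq_cvg; near=> v; rewrite /expNV ifT//; near: v.
    exact: lt_nbhsr.
  apply: (@continuous_comp _ _ _ (fun v : R => - v^-1) expR).
    by apply: cvgN; apply: cvgV => //; rewrite gt_eqF.
  exact: continuous_expR.
- have -> : expNV u = 0 by rewrite /expNV ltNge (ltW u0).
  apply: cvg_near_cst; near=> v; rewrite /expNV ifF//; apply/negbTE.
  by rewrite -leNgt ltW//; near: v; exact: lt_nbhsl.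
- have -> : expNV 0 = 0 by rewrite /expNV ltxx.
  apply/cvgr0Pnorm_le => e e0; near=> v.
  apply: le_trans (normr_expNV_le _) _; near: v.
  exact: (@nbhs0_le R R^o e e0).
Unshelve. all: by end_near. Qed.

Lemma zeta1E K t : zeta1 K t = K^-1 * expNV (1 - 4 * t ^+ 2).
Proof.
rewrite /zeta1 /expNV.
have -> : (`|t| < 2^-1) = (0 < 1 - 4 * t ^+ 2).
  rewrite -(ltr_pXn2r (n := 2))// ?nnegrE// real_normK ?num_real// subr_gt0.
  rewrite -[4](_ : (2^-1 ^+ 2)^-1 = _); last by field.
  by rewrite mulrC ltr_pdivrMr ?mul1r// exprn_gt0.
by case: ifP => _; rewrite ?mulr0// mulN1r.
Qed.

Lemma continuous_zeta1 K : continuous (zeta1 K).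
Proof.
rewrite (funext (zeta1E K)) => t; apply: cvgM; first exact: cvg_cst.
apply: (@continuous_comp _ _ _ (fun t : R => 1 - 4 * t ^+ 2)).
  apply: cvgB; first exact: cvg_cst.
  apply: cvgM; first exact: cvg_cst.
  exact: exprn_continuous.
exact: continuous_expNV.
Qed.

Lemma continuous_zeta1_scaled K s t :
  continuous (fun u => s^-1 * zeta1 K ((t - u) / s)).
Proof.
move=> u; apply: cvgM; first exact: cvg_cst.
apply: (@continuous_comp _ _ _ (fun u : R => (t - u) / s)).
  apply: cvgM; last exact: cvg_cst.
  by apply: cvgB; [exact: cvg_cst|exact: cvg_id].
exact: continuous_zeta1.
Qed.

Lemma zeta1_ge0 K t : 0 < K -> 0 <= zeta1 K t.
Proof.
move=> K0; rewrite /zeta1; case: ifP => // _.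
by rewrite mulr_ge0 ?expR_ge0// invr_ge0 ltW.
Qed.

Lemma zeta1_eq0 K t : 2^-1 <= `|t| -> zeta1 K t = 0.
Proof. by rewrite /zeta1 leNgt => /negbTE ->. Qed.

End Kernel.

(** * The primitive of the bump and its scaled integrals *)

Section Primitive.
Variables (R : realType) (K : R).
Hypothesis K_gt0 : 0 < K.
Hypothesis zeta1_norm :
  Lnorm (@lebesgue_measure R) 1%E (EFin \o zeta1 K) = 1%E.
Notation mu := (@lebesgue_measure R).
Implicit Types (s t x a b : R).

Lemma measurable_zeta1 (D : set R) : measurable_fun D (zeta1 K).
Proof.
apply: measurable_funTS; apply: continuous_measurable_fun.
exact: continuous_zeta1.
Qed.

Lemma integral_zeta1 : (\int[mu]_x (zeta1 K x)%:E = 1)%E.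
Proof.
move: zeta1_norm; rewrite Lnorm1 => <-; apply: eq_integral => x _ /=.
by rewrite ger0_norm// zeta1_ge0.
Qed.

Lemma integrable_zeta1 (D : set R) : measurable D ->
  mu.-integrable D (EFin \o zeta1 K).
Proof.
move=> mD; apply: (@integrableS _ _ _ _ setT) => //.
apply/integrableP; split.
  by apply/measurable_EFinP; apply: measurable_zeta1.
by move: zeta1_norm; rewrite Lnorm1 => ->; rewrite ltry.
Qed.

(** The scaled bumps integrate to differences of this primitive, so the sum over
    adjacent patch cores telescopes. *)
Definition zeta1_prim (x : R) : R := \int[mu]_(t in `]-oo, x]) zeta1 K t.

Lemma is_derive_zeta1_prim x : is_derive x 1 zeta1_prim (zeta1 K x).
Proof.
(* The fundamental theorem wants [x] strictly left of the right end point, hence [x + 1]. *)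
have xu : x < x + 1 by rewrite ltrDl.
have iz : mu.-integrable `]-oo, x + 1] (EFin \o zeta1 K).
  exact: integrable_zeta1.
have [d e] := continuous_FTC1 xu iz (ltNyr x) (@continuous_zeta1 _ K x).
by apply: DeriveDef; [exact: d|rewrite -derive1E; exact: e].
Qed.

Lemma zeta1_prim_left x : x <= - 2^-1 -> zeta1_prim x = 0.
Proof.
move=> x0; rewrite /zeta1_prim /Rintegral integral0_eq// => t /=.
rewrite in_itv/= => tx; rewrite zeta1_eq0// ler0_norm; last by lra.
by lra.
Qed.

(** The bump vanishes beyond [x], so the truncated integral is already the total mass, normalised by
    [zeta1_norm]. *)
Lemma zeta1_prim_right x : 2^-1 <= x -> zeta1_prim x = 1.
Proof.
move=> x0; rewrite /zeta1_prim /Rintegral integral_mkcond.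
rewrite [X in fine X](_ : _ = 1%E)// -integral_zeta1.
apply: eq_integral => t _; rewrite patchE; case: ifPn => //.
rewrite notin_setE/= in_itv/= => /negP; rewrite -ltNge => xt.
by rewrite zeta1_eq0// ger0_norm; lra.
Qed.

(** By the chain rule, [- zeta1_prim ((t - y) / s)] is an antiderivative in [y] of the integrand. *)
Lemma integral_zeta1_scaled s t a b : 0 < s -> a < b ->
  (\int[mu]_(y in `]a, b[) (s^-1 * zeta1 K ((t - y) / s))%:E =
   (zeta1_prim ((t - a) / s) - zeta1_prim ((t - b) / s))%:E)%E.
Proof.
move=> s0 ab.
have dF (y : R) : is_derive y 1 (fun y => - zeta1_prim ((t - y) / s))
    (s^-1 * zeta1 K ((t - y) / s)).
  have dg : is_derive y 1 (fun y => (t - y) / s) (- s^-1).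
    have -> : (fun y => (t - y) / s) = s^-1 \*: (cst t - id).
      by apply/funext => z /=; rewrite mulrC.
    by apply: is_derive_eq; rewrite sub0r scalerN /GRing.scale/= mulr1.
  have dZ := is_derive_zeta1_prim ((t - y) / s).
  have dc : is_derive y 1 (fun y => zeta1_prim ((t - y) / s))
    (zeta1 K ((t - y) / s) * - s^-1).
    exact: (@is_derive1_comp _ zeta1_prim (fun y => (t - y) / s)).
  by apply: is_derive_eq (is_deriveN dc) _; rewrite mulrN opprK mulrC.
have cF : continuous (fun y => - zeta1_prim ((t - y) / s)).
  by move=> y; apply/differentiable_continuous/derivable1_diffP; case: (dF y).
have cf := @continuous_zeta1_scaled R K s t.
(* Adding the two end points does not change the integral and gives the closed interval on which the
   fundamental theorem is stated. *)
rewrite -(integral_itv_bndoo true false).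
  rewrite (@continuous_FTC2 _ _ (fun y => - zeta1_prim ((t - y) / s)))//.
  - by rewrite -EFinB opprK addrC.
  - by apply: continuous_subspaceT => y.
  - split => [y _||]; first by case: (dF y).
      by apply: cvg_at_right_filter; exact: cF.
    by apply: cvg_at_left_filter; exact: cF.
  - by move=> y _; rewrite derive1E; have [_ ->] := dF y.
apply/measurable_EFinP/measurable_funTS.
exact: continuous_measurable_fun.
Qed.

End Primitive.

(** * Polynomials as functions with vanishing higher derivatives *)

Section Polyfun.
Variable R : realType.
Implicit Types (f g : R * R -> R) (c : R) (a : nat * nat) (x v : R * R).

(** Polynomial functions of degree less than [n], described by the vanishing of
    all iterated partial derivatives of order [n]. *)
Fixpoint polyfun (n : nat) f : Prop :=
  if n is n'.+1 then
    forall b, (forall x, derivable f x (if b then (0, 1) else (1, 0))) /\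
              polyfun n' (partial b f)
  else f = cst 0.

Lemma polyfun0 n : polyfun n (cst 0).
Proof.
elim: n => //= n IH b; split; first by move=> x; exact: derivable_cst.
by rewrite (_ : partial b _ = cst 0)//; apply/funext => x; exact: derive_cst.
Qed.

Lemma polyfunD n f g : polyfun n f -> polyfun n g -> polyfun n (f + g).
Proof.
elim: n f g => [f g /= -> ->|n IH f g /= Pf Pg b].
  by apply/funext => x /=; rewrite addrfctE addr0.
have [[df Pdf] [dg Pdg]] := (Pf b, Pg b).
split; first by move=> x; exact: derivableD.
rewrite (_ : partial b _ = partial b f + partial b g); first exact: IH.
by apply/funext => x; exact: deriveD.
Qed.

Lemma polyfunZ n c f : polyfun n f -> polyfun n (c \*: f).
Proof.
elim: n f => [f /= ->|n IH f /= Pf b].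
  by apply/funext => x; exact: scaler0.
have [df Pdf] := Pf b.
split; first by move=> x; exact: derivableZ.
rewrite (_ : partial b _ = c \*: partial b f); first exact: IH.
by apply/funext => x; exact: deriveZ.
Qed.

Lemma polyfun_sum (I : Type) (r : seq I) (p : pred I) (F : I -> R * R -> R) n :
  (forall i, p i -> polyfun n (F i)) ->
  polyfun n (fun x => \sum_(i <- r | p i) F i x).
Proof.
move=> PF; elim: r => [|i r IH].
  by under eq_fun do rewrite big_nil; exact: polyfun0.
under eq_fun do rewrite big_cons; case: (boolP (p i)) => // pi.
exact: (@polyfunD _ (F i) (fun x => \sum_(i <- r | p i) F i x) (PF _ pi) IH).
Qed.

Lemma is_derive_fst x v : is_derive x v (fst : R * R -> R) v.1.
Proof.
have c : h^-1 *: ((h *: v + x).1 - x.1) @[h --> (0 : R)^'] --> v.1.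
  apply: cvg_near_cst; near=> h; rewrite /= addrK scalerA mulVf ?scale1r//.
  by near: h; exact: nbhs_dnbhs_neq.
by apply: DeriveDef; [apply/cvg_ex; exists v.1|exact: cvg_lim].
Unshelve. all: by end_near. Qed.

Lemma is_derive_snd x v : is_derive x v (snd : R * R -> R) v.2.
Proof.
have c : h^-1 *: ((h *: v + x).2 - x.2) @[h --> (0 : R)^'] --> v.2.
  apply: cvg_near_cst; near=> h; rewrite /= addrK scalerA mulVf ?scale1r//.
  by near: h; exact: nbhs_dnbhs_neq.
by apply: DeriveDef; [apply/cvg_ex; exists v.2|exact: cvg_lim].
Unshelve. all: by end_near. Qed.

Lemma is_derive_monomial a x v : is_derive x v (monomial a)
  (x.1 ^+ a.1 * (a.2%:R * x.2 ^+ a.2.-1 * v.2) +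
   x.2 ^+ a.2 * (a.1%:R * x.1 ^+ a.1.-1 * v.1)).
Proof.
have d1 := is_deriveX a.1 (is_derive_fst x v).
have d2 := is_deriveX a.2 (is_derive_snd x v).
have -> : monomial a = (fst ^+ a.1 : R * R -> R) * (snd ^+ a.2).
  by apply/funext => y; rewrite /monomial/= mulrfctE !exprfctE.
by apply: is_derive_eq (is_deriveM d1 d2) _; rewrite !exprfctE.
Qed.

Lemma polyfun_monomial a n : (mdeg a < n)%N -> polyfun n (monomial a).
Proof.
elim: n a => // n IH a an b; split=> [x|].
  by case: (is_derive_monomial a x (if b then (0, 1) else (1, 0))).
case: b; case: a an => a1 a2; rewrite /mdeg /= ltnS => an.
- rewrite (_ : partial true _ = a2%:R \*: monomial (a1, a2.-1)); last first.
    apply/funext => x; rewrite /partial.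
    have [_ ->] := is_derive_monomial (a1, a2) x (0, 1).
    by rewrite /monomial /= /GRing.scale /= !mulr0 addr0 mulr1 mulrCA.
  (* For exponent 0 the truncated predecessor does not lower the degree, so the induction hypothesis
     is out of reach; there the factor [a2%:R] is 0 instead. *)
  case: a2 an => [|a2] an.
    rewrite (_ : _ \*: _ = cst 0); first exact: polyfun0.
    by apply/funext => x /=; rewrite scale0r.
  by apply: polyfunZ; apply: IH; rewrite /mdeg/= -addnS.
- rewrite (_ : partial false _ = a1%:R \*: monomial (a1.-1, a2)); last first.
    apply/funext => x; rewrite /partial.
    have [_ ->] := is_derive_monomial (a1, a2) x (1, 0).
    by rewrite /monomial /= /GRing.scale /= !mulr0 add0r mulr1 mulrC -!mulrA.
  case: a1 an => [|a1] an.
    rewrite (_ : _ \*: _ = cst 0); first exact: polyfun0.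
    by apply/funext => x /=; rewrite scale0r.
  by apply: polyfunZ; apply: IH; rewrite /mdeg/= -addSn.
Qed.

Lemma polyfun_iter_partial b k n f :
  polyfun (k + n) f -> polyfun n (iter k (partial b) f).
Proof.
elim: k n => // k IH n; rewrite addSnnS => /IH /(_ b)[_].
by [].
Qed.

(** Each partial derivative, in either direction, lowers the order by one, so [mdeg a] of them use
    up all of [n]. *)
Lemma pderiv_polyfun a n f : polyfun n f -> mdeg a = n -> pderiv a f = cst 0.
Proof.
(* The equation with [cst 0] is [polyfun 0] unfolded, hence the argument 0. *)
move=> Pf an; rewrite /pderiv; apply: (@polyfun_iter_partial _ _ 0).
by rewrite addn0; apply: polyfun_iter_partial; rewrite addnC -/(mdeg a) an.
Qed.

End Polyfun.

(** * Product form and finite sums of the partition of unity *)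

Section PartitionOfUnity.
Variable R : realType.
Notation mu := (@lebesgue_measure R).

Lemma ge0_integral_leb2M (f g : R -> R) :
  measurable_fun setT f -> measurable_fun setT g ->
  (forall t, 0 <= f t) -> (forall t, 0 <= g t) ->
  (\int[leb2 R]_z (f z.1 * g z.2)%:E =
   \int[mu]_t (f t)%:E * \int[mu]_t (g t)%:E)%E.
Proof.
move=> mf mg f0 g0; rewrite /leb2 fubini_tonelli1; first last.
- by move=> z; rewrite lee_fin mulr_ge0.
- apply/measurable_EFinP; apply: measurable_funM.
    exact: (measurableT_comp mf measurable_fst).
  exact: (measurableT_comp mg measurable_snd).
rewrite /fubini_F /=.
under eq_integral => t _.
  under eq_integral => u _ do rewrite EFinM.
  rewrite ge0_integralZl//; last 3 first.
  - exact/measurable_EFinP.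
  - by move=> u _; rewrite lee_fin.
  - by rewrite lee_fin.
  over.
rewrite ge0_integralZr//.
- exact/measurable_EFinP.
- by move=> t _; rewrite lee_fin.
- by apply: integral_ge0 => t _; rewrite lee_fin.
Qed.

Variables K s : R.
Hypothesis K_gt0 : 0 < K.
Hypothesis zeta1_norm : Lnorm mu 1%E (EFin \o zeta1 K) = 1%E.
Hypothesis s_gt0 : 0 < s.

(** The antiderivative at the left edge of core [k]. The right edge of that core is the left edge of
    core [k + 1], so [pou1] is a difference of consecutive terms. *)
Definition pou_edge (k : int) (t : R) : R :=
  - zeta1_prim K ((t - (k%:~R - 2^-1) * s) / s).

Definition pou1 (k : int) (t : R) : R := pou_edge (k + 1) t - pou_edge k t.

Definition pou1_integrand (k : int) (t u : R) : R :=
  \1_(`](k%:~R - 2^-1) * s, (k%:~R + 2^-1) * s[%classic) u *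
  (s^-1 * zeta1 K ((t - u) / s)).

Lemma measurable_pou1_integrand k t :
  measurable_fun setT (pou1_integrand k t).
Proof.
apply: measurable_funM; first exact: measurable_indic.
apply: continuous_measurable_fun; exact: continuous_zeta1_scaled.
Qed.

Lemma pou1_integrand_ge0 k t u : 0 <= pou1_integrand k t u.
Proof.
by rewrite !mulr_ge0 ?indicE ?ler0n ?zeta1_ge0// invr_ge0 ltW.
Qed.

Lemma integral_pou1_integrand k t :
  (\int[mu]_u (pou1_integrand k t u)%:E = (pou1 k t)%:E)%E.
Proof.
have ab : (k%:~R - 2^-1) * s < (k%:~R + 2^-1) * s by rewrite ltr_pM2r//; lra.
transitivity (\int[mu]_(u in
    `]((k%:~R - 2^-1) * s)%R, ((k%:~R + 2^-1) * s)%R[)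
      (s^-1 * zeta1 K ((t - u) / s))%:E)%E.
  rewrite [RHS]integral_mkcond; apply: eq_integral => u _.
  rewrite /pou1_integrand patchE indicE; case: ifP => _.
    by rewrite mul1r.
  by rewrite mul0r.
rewrite integral_zeta1_scaled// /pou1 /pou_edge opprK addrC.
congr (- zeta1_prim K ((t - _ * s) / s) + _)%:E.
by rewrite intrD; lra.
Qed.

(** Patch core and kernel are both products over the two axes, and [s ^- 2] gives one factor [s^-1]
    to each; Tonelli then separates the convolution. *)
Lemma pouE i x : pou K s i x = pou1 i.1 x.1 * pou1 i.2 x.2.
Proof.
rewrite /pou /convolution /Rintegral.
rewrite [X in fine X](_ : _ = (pou1 i.1 x.1 * pou1 i.2 x.2)%:E)//.
rewrite EFinM -!integral_pou1_integrand -ge0_integral_leb2M; last 4 first.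
- exact: measurable_pou1_integrand.
- exact: measurable_pou1_integrand.
- exact: pou1_integrand_ge0.
- exact: pou1_integrand_ge0.
apply: eq_integral => y _; congr EFin.
rewrite /pou1_integrand /zeta_scaled /zeta2 /= mulrACA; congr (_ * _).
  rewrite !indicE -natrM mulnb; congr (_ : bool)%:R.
  apply/idP/andP; rewrite !inE /patch_core /= !in_itv/=.
    by case.
  by case.
by rewrite mulrACA -exprVn expr2.
Qed.

Definition grid_range (M : nat) : seq int :=
  [seq n%:Z - M%:Z | n <- iota 0 (M.*2).+1].

Definition grid_box (M : nat) : seq (int * int) :=
  [seq (k, l) | k <- grid_range M, l <- grid_range M].

(** The sum telescopes to the outermost edges, at plus and minus [(M + 1/2) * s]. Both are at least
    [s / 2] away from [t], where the primitive has reached its constant values 0 and 1. *)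
Lemma sum_pou1 M t : `|t| <= M%:R * s ->
  \sum_(k <- grid_range M) pou1 k t = 1.
Proof.
move=> tM; rewrite big_map.
pose F (n : nat) := pou_edge (n%:Z - M%:Z) t.
rewrite (eq_bigr (fun n => F n.+1 - F n)); last first.
  by move=> n _; rewrite /pou1 /F addrAC -PoszD addn1.
have -> : iota 0 (M.*2).+1 = index_iota 0 (M.*2).+1.
  by rewrite /index_iota subn0.
rewrite telescope_sumr// /F /pou_edge opprK.
move: tM; rewrite ler_norml => /andP[t1 t2].
rewrite zeta1_prim_left// ?zeta1_prim_right//.
- by rewrite oppr0 add0r.
- rewrite ler_pdivlMr// sub0r intrN -pmulrn; lra.
- rewrite ler_pdivrMr// -addn1 -addnn intrB -!pmulrn !natrD; lra.
Qed.

Lemma sum_pou M x : `|x.1| <= M%:R * s -> `|x.2| <= M%:R * s ->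
  \sum_(i <- grid_box M) pou K s i x = 1.
Proof.
move=> x1 x2; rewrite big_allpairs /=.
under eq_bigr => k _.
  under eq_bigr => l _ do rewrite pouE /=.
  rewrite -mulr_sumr sum_pou1// mulr1; over.
exact: sum_pou1.
Qed.

End PartitionOfUnity.

(** * Polynomials in the ansatz space and in the stabilization form *)

Section Reproduction.
Variable R : realType.
Implicit Types (s K : R) (Om D : set (R * R)) (P M : nat) (f g : R * R -> R).

Lemma fict_domain_bounded s Om : 0 < s -> bounded_set Om ->
  exists M, forall x, fict_domain s Om x ->
    `|x.1| <= M%:R * s /\ `|x.2| <= M%:R * s.
Proof.
move=> s0 [B [_ /(_ (B + 1))]]; rewrite ltrDl ltr01 => /(_ isT) HB.
set C := B + 1 in HB.
(* The coordinates of a point of [Om] are at most [C]. One [s] is for the side of the cell, a second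
   for approximating a point of its closure from inside the cell. *)
have [M CM] : exists M : nat, C / s + 2 <= M%:R.
  by exists (Num.truncn (C / s + 2)).+1; exact/ltW/truncnS_gt.
have {}CM : C + 2 * s <= M%:R * s.
  by rewrite -ler_pdivrMr// mulrDl mulfK ?gt_eqF.
exists M => x /interior_subset[i /= i0 clx].
(* Positive measure of the intersection yields a common point. *)
have [z [[z1 z2] Oz]] : cell s i `&` Om !=set0.
  by apply/set0P; apply: contraTneq i0 => ->; rewrite measure0 ltxx.
have [y [[y1 y2] [/= xy1 xy2]]] := clx _ (nbhsx_ballx x s s0).
have : `|z| <= C by exact: HB Oz.
rewrite prod_normE ge_max => /andP[zC1 zC2].
move: xy1 xy2 zC1 zC2 y1 y2 z1 z2; rewrite /ball/=.
rewrite !ltr_norml !ler_norml !intrD.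
do 4 move=> /andP[? ?].
by do 4 move=> /andP[? ?]; split; apply/andP; split; lra.
Qed.

(** The double sum copies the inner one of [Vspace], so that a product with [pou] matches it term by
    term. *)
Definition polyspan P f : Prop := exists c : nat * nat -> R, forall x,
  f x = \sum_(a1 < P.+1) \sum_(a2 < P.+1 | (a1 + a2 <= P)%N)
    c (nat_of_ord a1, nat_of_ord a2) *
    monomial (nat_of_ord a1, nat_of_ord a2) x.

Lemma polyspan_monomial P a : (mdeg a <= P)%N -> polyspan P (monomial a).
Proof.
case: a => a1 a2; rewrite /mdeg/= => aP.
have a1P : (a1 < P.+1)%N by rewrite ltnS (leq_trans _ aP)// leq_addr.
have a2P : (a2 < P.+1)%N by rewrite ltnS (leq_trans _ aP)// leq_addl.
(* Kronecker delta coefficients: only the term of index [(a1, a2)] survives. *)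
exists (fun b => (b == (a1, a2))%:R) => x.
rewrite (bigD1 (Ordinal a1P))//= (bigD1 (Ordinal a2P))//= eqxx mul1r.
rewrite !big1 ?addr0// => [b1 b1a|b2 /andP[_ b2a]].
  rewrite big1// => b2 _; rewrite xpair_eqE.
  by rewrite -(inj_eq val_inj)/= in b1a; rewrite (negbTE b1a) mul0r.
rewrite xpair_eqE eqxx.
by rewrite -(inj_eq val_inj)/= in b2a; rewrite (negbTE b2a) mul0r.
Qed.

Lemma polyspanD P f g : polyspan P f -> polyspan P g ->
  polyspan P (fun x => f x + g x).
Proof.
move=> [c fE] [d gE]; exists (fun b => c b + d b) => x.
rewrite fE gE -big_split; apply: eq_bigr => a1 _.
by rewrite -big_split; apply: eq_bigr => a2 _; rewrite mulrDl.
Qed.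

Lemma polyspanN P f : polyspan P f -> polyspan P (fun x => - f x).
Proof.
move=> [c fE]; exists (fun b => - c b) => x.
rewrite fE -sumrN; apply: eq_bigr => a1 _.
by rewrite -sumrN; apply: eq_bigr => a2 _; rewrite mulNr.
Qed.

Lemma polyfun_polyspan P f : polyspan P f -> polyfun P.+1 f.
Proof.
move=> [c /funext ->]; apply: polyfun_sum => a1 _; apply: polyfun_sum => a2 a12.
by apply: polyfunZ; apply: polyfun_monomial; rewrite ltnS.
Qed.

(** Multiply [f] by the sum of the [pou K s i] over the block, which is 1 on [D]; every node
    receives the same coefficients [c]. *)
Lemma Vspace_polyspan K s P M D f : 0 < K ->
  Lnorm (@lebesgue_measure R) 1%E (EFin \o zeta1 K) = 1%E -> 0 < s ->
  (forall x, D x -> `|x.1| <= M%:R * s /\ `|x.2| <= M%:R * s) ->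
  polyspan P f -> Vspace K s P D f.
Proof.
move=> K0 K1 s0 DM [c fE]; exists (grid_box M), (fun=> c) => x /DM[x1 x2].
rewrite -[LHS]mul1r -(sum_pou K0 K1 s0 x1 x2) mulr_suml.
apply: eq_bigr => i _; rewrite fE mulr_sumr; apply: eq_bigr => a1 _.
by rewrite mulr_sumr; apply: eq_bigr => a2 _; rewrite mulrCA.
Qed.

(** Every integrand contains a derivative of [g] of order [k + (P.+1 - k) = P.+1], which is zero. *)
Lemma jform_polyfun s Om mv P f g : polyfun P.+1 g -> jform s Om mv P f g = 0.
Proof.
move=> Pg; rewrite /jform fsbig1 ?mulr0// => i _; apply: big1 => k _.
rewrite (pderiv_polyfun Pg); last by rewrite /mdeg/= subnKC// -ltnS.
by rewrite /Rintegral integral0_eq// => x _; rewrite mulr0.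
Qed.

(** Bridges two conventions: the conserved quantities put the weight on the left, the Galerkin
    equation puts the test function on the right. *)
Lemma L2_innerC Om f g : L2_inner Om f g = L2_inner Om g f.
Proof. by apply: eq_Rintegral => x _; rewrite mulrC. Qed.

Lemma circulationE Om f : circulation Om f = L2_inner Om f (fun=> 1).
Proof. exact: (L2_innerC Om (fun=> 1)). Qed.

Lemma linear_momentumE Om f : linear_momentum Om f =
  (L2_inner Om f (fun x => x.2), L2_inner Om f (fun x => - x.1)).
Proof. by rewrite L2_innerC (L2_innerC Om f (fun x => - x.1)). Qed.

Lemma angular_momentumE Om f : angular_momentum Om f =
  L2_inner Om f (fun x => x.1 ^+ 2 + x.2 ^+ 2).
Proof. exact: (L2_innerC Om (fun x => x.1 ^+ 2 + x.2 ^+ 2)). Qed.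

End Reproduction.

(** * Conservation of moments by the Galerkin solution *)

Theorem mainTheorem6 (R : realType) (Om : set (R * R))
  (hdomain : is_domain Om) (hbounded : bounded_set Om)
  (hstein : stein_extension Om)
  (K : R) (hK : 0 < K)
  (hzeta : Lnorm (@lebesgue_measure R) 1%E (EFin \o zeta1 K) = 1%E)
  (mesh : set R) (mv : R -> set (int * int))
  (hgrid : grid_assumption Om mesh mv)
  (s : R) (hs : mesh s)
  (eps : R) (heps : 0 < eps) (P m : nat)
  (omh : (R * R -> R) -> R) (homh : sobolev_dual Om m.+1 omh)
  (oms : R * R -> R) (homs : Vspace K s P (fict_domain s Om) oms)
  (hsol : forall v, Vspace K s P (fict_domain s Om) v ->
     Aform s Om (mv s) P eps oms v = omh v) :
  (forall a : nat * nat, (mdeg a <= P)%N ->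
     L2_inner Om oms (monomial a) = omh (monomial a)) /\
  (P = 1%N ->
     circulation Om oms = circulation_fun omh /\
     linear_momentum Om oms = linear_momentum_fun omh) /\
  (P = 2%N ->
     [/\ circulation Om oms = circulation_fun omh,
         linear_momentum Om oms = linear_momentum_fun omh &
         angular_momentum Om oms = angular_momentum_fun omh]).
Proof.
have [mesh_gt0 _] := hgrid; have [s0 _] := mesh_gt0 _ hs.
have [M OmM] := fict_domain_bounded s0 hbounded.
(* Stated for all polynomials, because the weights [- x.1] and [x.1 ^+ 2 + x.2 ^+ 2] are not
   monomials but can be tested with directly. *)
have key f : polyspan P f -> L2_inner Om oms f = omh f.
  move=> Pf; rewrite -(hsol _ (Vspace_polyspan hK hzeta s0 OmM Pf)) /Aform.
  by rewrite (jform_polyfun _ _ _ _ (polyfun_polyspan Pf)) mulr0 addr0.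
have span a (f : R * R -> R) :
    (mdeg a <= P)%N -> monomial a =1 f -> polyspan P f.
  by move=> aP /funext <-; exact: polyspan_monomial.
have I0 : circulation Om oms = circulation_fun omh.
  rewrite circulationE; apply: key; apply: (span (0, 0)%N) => // x.
  by rewrite /monomial mulr1.
have I1 : (0 < P)%N -> linear_momentum Om oms = linear_momentum_fun omh.
  move=> P0; rewrite linear_momentumE; congr pair; apply: key.
    by apply: (span (0, 1)%N) => // x; rewrite /monomial mul1r.
  by apply/polyspanN/(span (1, 0)%N) => // x; rewrite /monomial mulr1.
split; first by move=> a aP; apply: key; exact: polyspan_monomial.
split=> P12; first by split; [exact: I0|apply: I1; rewrite P12].
split; [exact: I0|by apply: I1; rewrite P12|].
rewrite angular_momentumE; apply: key; apply: polyspanD.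
  by apply: (span (2, 0)%N) => [|x]; [rewrite P12|rewrite /monomial mulr1].
by apply: (span (0, 2)%N) => [|x]; [rewrite P12|rewrite /monomial mul1r].
Qed.
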